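(* If $P(x|y\uparrow)$ is a causal semimeasure associated with an enumerable conditional semimeasure $P(x|y)>0$, then there exist an enumerable conditional semimeasure $Q(x|y)$, with associated causal semimeasure $Q(x|y\uparrow)$, and a constant $c>0$, such that for every sufficiently large $n$ there are $x,y\in 2^n$ with $$\log\frac{Q(x|y\uparrow)}{P(x|y\uparrow)}\ >\ c\,n .$$
   Context: $\log$ is base 2; $2^n$ is the set of binary strings of length $n$; $x^i=x_1\dots x_i$, and $x^0=\epsilon$ is the empty string. All semimeasures are length conditional. A conditional semimeasure is a non-negative real function $P(x|y)$, defined for $x,y\in 2^n$, $n\in\omega$, with $\sum_{x\in 2^n}P(x|y)\le 1$ for every $n$ and every $y\in 2^n$; $P(x|y)>0$ means that all its values are positive. A univariate semimeasure $P(y)$ and a bivariate semimeasure $P(x,y)$ are non-negative real functions with $\sum_{y\in 2^n}P(y)\le 1$, respectively $\sum_{x,y\in 2^n}P(x,y)\le 1$, for every $n$. A real function is enumerable if it is the limit of a computable nondecreasing sequence of rational functions. For a bivariate semimeasure and $i,j\le n$ (with $n$ fixed) put $P(x^i,y^j)=\sum\{P(x^iv,y^jw):v\in 2^{n-i},\,w\in 2^{n-j}\}$. The causal semimeasure associated with a conditional semimeasure $P(x|y)$ is $$P(x|y\uparrow)=\prod_{i=1}^{n}P(x_i|x^{i-1},y^{i-1}),\qquad P(x_i|x^{i-1},y^{i-1})=\frac{P(x^i,y^{i-1})}{P(x^{i-1},y^{i-1})},$$ where $P(x,y)$ is a bivariate semimeasure having $P(x|y)$ as its conditional semimeasure, that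 is, $P(x,y)=P(x|y)P(y)$ with $P(y)>0$ an enumerable univariate semimeasure. $Q(x|y\uparrow)$ is obtained from $Q(x|y)$ in the same way. *)

(* Defs.v *)
From HB Require Import structures.
From mathcomp Require Import all_boot all_order all_algebra.
From mathcomp Require Import all_classical all_reals all_analysis.
Import numFieldNormedType.Exports.
Import Order.TTheory GRing.Theory Num.Theory.

Set Implicit Arguments.
Unset Strict Implicit.
Unset Printing Implicit Defensive.

Local Open Scope classical_set_scope.
Local Open Scope ring_scope.

(* Total recursive functions of [k] natural arguments (Kleene): the least class
   containing zero, successor and the projections, and closed under
   composition, primitive recursion and minimisation of regular functions.
   The defining equations are extensional, so no function extensionality is
   needed to recognise a member of the class. *)
Inductive recursive : forall k : nat, (k.-tuple nat -> nat) -> Prop :=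
| recursive_zero k (h : k.-tuple nat -> nat) :
    (forall v, h v = 0%N) -> recursive h
| recursive_succ (h : 1.-tuple nat -> nat) :
    (forall v, h v = (thead v).+1) -> recursive h
| recursive_proj k (i : 'I_k) (h : k.-tuple nat -> nat) :
    (forall v, h v = tnth v i) -> recursive h
| recursive_comp k m (f : m.-tuple nat -> nat)
    (g : 'I_m -> k.-tuple nat -> nat) (h : k.-tuple nat -> nat) :
    recursive f -> (forall i, recursive (g i)) ->
    (forall v, h v = f [tuple g i v | i < m]) -> recursive h
| recursive_prim k (f : k.-tuple nat -> nat) (g : k.+2.-tuple nat -> nat)
    (h : k.+1.-tuple nat -> nat) :
    recursive f -> recursive g ->
    (forall v : k.-tuple nat, h [tuple of 0%N :: v] = f v) ->
    (forall (m : nat) (v : k.-tuple nat),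
       h [tuple of m.+1 :: v]
       = g [tuple of m :: h [tuple of m :: v] :: v]) ->
    recursive h
| recursive_min k (f : k.+1.-tuple nat -> nat) (h : k.-tuple nat -> nat) :
    recursive f ->
    (forall v : k.-tuple nat,
       f [tuple of h v :: v] = 0%N /\
       forall m : nat, (m < h v)%N -> f [tuple of m :: v] <> 0%N) ->
    recursive h.

Definition computable_rat (k : nat) (g : k.-tuple nat -> rat) : Prop :=
  exists a b d : k.-tuple nat -> nat,
    [/\ recursive a, recursive b, recursive d &
        forall v, g v = ((a v)%:R - (b v)%:R) / (d v).+1%:R].

Definition bits (n : nat) : finType := n.-tuple bool.

(* The number with binary expansion 1s: a bijection between binary strings and
   positive integers. *)
Definition bits_code (s : seq bool) : nat :=
  foldl (fun (a : nat) (b : bool) => (a.*2 + b)%N) 1%N s.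

Section Semimeasures.
Variable R : realType.

(* In a conditional [P : bifun], [P n x y] is P(x|y). *)
Definition unifun := forall n : nat, bits n -> R.
Definition bifun := forall n : nat, bits n -> bits n -> R.

Definition enumerable1 (p : unifun) : Prop :=
  exists2 g : 2.-tuple nat -> rat, computable_rat g &
    forall (n : nat) (y : bits n),
      nondecreasing_seq (fun t : nat => g [tuple t; bits_code y]) /\
      (fun t : nat => ratr (g [tuple t; bits_code y]) : R) @ \oo --> p n y.

Definition enumerable2 (P : bifun) : Prop :=
  exists2 g : 3.-tuple nat -> rat, computable_rat g &
    forall (n : nat) (x y : bits n),
      nondecreasing_seq (fun t : nat => g [tuple t; bits_code x; bits_code y]) /\
      (fun t : nat => ratr (g [tuple t; bits_code x; bits_code y]) : R) @ \oo --> P n x y.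

Definition univariate_semimeasure (p : unifun) : Prop :=
  (forall n (y : bits n), 0 <= p n y) /\
  (forall n, \sum_(y : bits n) p n y <= 1).

Definition bivariate_semimeasure (P : bifun) : Prop :=
  (forall n (x y : bits n), 0 <= P n x y) /\
  (forall n, \sum_(x : bits n) \sum_(y : bits n) P n x y <= 1).

Definition conditional_semimeasure (P : bifun) : Prop :=
  (forall n (x y : bits n), 0 <= P n x y) /\
  (forall n (y : bits n), \sum_(x : bits n) P n x y <= 1).

Definition prefix_sum (P : bifun) (n : nat) (u v : seq bool) : R :=
  \sum_(x : bits n | prefix u x) \sum_(y : bits n | prefix v y) P n x y.

(* Here i runs from 0 to n - 1, so the i-th factor is P(x_{i+1} | x^i, y^i).
   Division by zero yields zero; for nonnegative [P] a vanishing denominator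
   thus makes the product zero. *)
Definition causal (P : bifun) (n : nat) (x y : bits n) : R :=
  \prod_(i < n) (prefix_sum P n (take i.+1 x) (take i y) /
                 prefix_sum P n (take i x) (take i y)).

(* [C] is a causal semimeasure associated with the conditional semimeasure [P];
   it depends on the choice of the univariate semimeasure [p]. *)
Definition causal_associated (P C : bifun) : Prop :=
  exists (p : unifun) (J : bifun),
    [/\ univariate_semimeasure p, enumerable1 p,
        (forall n (y : bits n), 0 < p n y),
        bivariate_semimeasure J /\
        (forall n (x y : bits n), J n x y = P n x y * p n y) &
        forall n (x y : bits n), C n x y = causal J x y].

(* [ln] is total, with ln r = 0 for r <= 0. *)
Definition log2 (r : R) : R := ln r / ln 2.

End Semimeasures.

(* Main.v *)
(** Fix n and let the environment play y = 0^n.  The nat-valued approximations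
    of J = P(x|y)P(y) are nondecreasing in time t; let N_t(x) and D_t(x) be the
    products of the numerators and of the denominators of the causal
    probability of x.  Both only grow, so any rise of N_t(x)/D_t(x) by a factor
    2 after time s forces the potential prod_x N_t(x) to double after s.  As
    the potential is bounded by 1, it crosses only finitely many dyadic levels.
    Each time the potential enters a new level, the increase of the level is
    added as mass of Q to the greedy string, which takes the less likely bit at
    every step and hence has causal probability at most 2^-n at that time.  The
    last such string z receives at least half of the total mass of Q, so that
    its causal Q-probability is at least 1/2 while its causal P-probability is
    at most 2 * 2^-n.  As levels are at most 1, Q is a semimeasure. *)

Require Import Defs.
From HB Require Import structures.
From mathcomp Require Import all_boot all_order all_algebra.
From mathcomp Require Import all_classical all_reals all_analysis.
From mathcomp Require Import zify.
Import numFieldNormedType.Exports.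
Import Order.TTheory GRing.Theory Num.Theory.

Set Implicit Arguments.
Unset Strict Implicit.
Unset Printing Implicit Defensive.

Local Open Scope classical_set_scope.
Local Open Scope nat_scope.

Local Notation arg := (nth 0%N).

(** * Closure properties of recursive functions *)

(* Functions of a list rather than of a tuple: the [i]-th argument is
   [arg s i], which is [0] out of range, and a bound variable is pushed in front
   of the list, so that no ordinals are needed. *)
Definition Rec (k : nat) (F : seq nat -> nat) : Prop :=
  recursive (fun v : k.-tuple nat => F v).

Section RecClosure.
Variable k : nat.
Implicit Types F G H b : seq nat -> nat.

Lemma Rec_const c : Rec k (fun=> c).
Proof.
rewrite /Rec; elim: c => [|c IHc]; first exact: recursive_zero.
apply: (@recursive_comp k 1 (fun v => (thead v).+1) (fun _ _ => c)) => [||v].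
- exact: recursive_succ.
- by move=> _; exact: IHc.
- by rewrite /thead tnth_mktuple.
Qed.

Lemma Rec_nth i : Rec k (fun s => arg s i).
Proof.
have [ik|ki] := ltnP i k.
  by apply: (@recursive_proj k (Ordinal ik)) => v; rewrite (tnth_nth 0).
by apply: recursive_zero => v; rewrite nth_default ?size_tuple.
Qed.

Lemma Rec_comp F (Gs : seq (seq nat -> nat)) :
    Rec (size Gs) F -> (forall i, i < size Gs -> Rec k (nth (fun=> 0) Gs i)) ->
  Rec k (fun s => F [seq G s | G <- Gs]).
Proof.
move=> rF rG; apply: (recursive_comp rF (fun i : 'I__ => rG i (ltn_ord i))) => v.
congr F; apply: (@eq_from_nth _ 0); rewrite size_map ?size_tuple// => i iG.
rewrite (nth_map (fun=> 0))//.
have := tnth_nth 0 [tuple nth (fun=> 0) Gs j v | j < size Gs] (Ordinal iG).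
by rewrite tnth_mktuple.
Qed.

Lemma Rec_comp1 (f : nat -> nat) F :
  Rec 1 (fun s => f (arg s 0)) -> Rec k F -> Rec k (fun s => f (F s)).
Proof. by move=> rf rF; apply: (Rec_comp (Gs := [:: F]) rf) => -[]. Qed.

Lemma Rec_comp2 (f : nat -> nat -> nat) F G :
    Rec 2 (fun s => f (arg s 0) (arg s 1)) -> Rec k F -> Rec k G ->
  Rec k (fun s => f (F s) (G s)).
Proof. by move=> rf rF rG; apply: (Rec_comp (Gs := [:: F; G]) rf) => -[|[]]. Qed.

Lemma Rec_comp3 (f : nat -> nat -> nat -> nat) F G H :
    Rec 3 (fun s => f (arg s 0) (arg s 1) (arg s 2)) -> Rec k F -> Rec k G -> Rec k H ->
  Rec k (fun s => f (F s) (G s) (H s)).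
Proof.
by move=> rf rF rG rH; apply: (Rec_comp (Gs := [:: F; G; H]) rf) => -[|[|[]]].
Qed.

Lemma Rec_comp5 (f : nat -> nat -> nat -> nat -> nat -> nat) F1 F2 F3 F4 F5 :
    Rec 5 (fun s => f (arg s 0) (arg s 1) (arg s 2) (arg s 3) (arg s 4)) ->
    Rec k F1 -> Rec k F2 -> Rec k F3 -> Rec k F4 -> Rec k F5 ->
  Rec k (fun s => f (F1 s) (F2 s) (F3 s) (F4 s) (F5 s)).
Proof.
move=> rf r1 r2 r3 r4 r5.
by apply: (Rec_comp (Gs := [:: F1; F2; F3; F4; F5]) rf) => -[|[|[|[|[]]]]].
Qed.

End RecClosure.

(** The equations in the constructors of [recursive] are extensional, so composing with all the
    projections replaces a function by one that agrees with it on lists of length [k]. *)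
Lemma Rec_ext k F G : (forall s, size s = k -> F s = G s) -> Rec k F -> Rec k G.
Proof.
move=> FG rF; have ri (i : 'I_k) : recursive (fun v : k.-tuple nat => tnth v i).
  exact: recursive_proj.
apply: (recursive_comp rF ri) => v.
rewrite -FG ?size_tuple//; congr (F (tval _)).
by apply: eq_from_tnth => i; rewrite tnth_mktuple.
Qed.

Lemma Rec_reindex m k (js : seq nat) F :
  size js = m -> Rec m F -> Rec k (fun s => F [seq arg s j | j <- js]).
Proof.
move=> jsm rF; apply: (Rec_ext (F := fun s =>
  F [seq G s | G : seq nat -> nat <- [seq (fun s => arg s j) | j <- js]])).
  by move=> s _; rewrite -map_comp.
apply: Rec_comp; rewrite size_map jsm // => i ij.
by rewrite (nth_map 0) ?jsm//; exact: Rec_nth.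
Qed.

Lemma map_arg_iota k i s : size s = i + k ->
  [seq arg s j | j <- iota i k] = drop i s.
Proof.
move=> sk; apply: (@eq_from_nth _ 0); rewrite size_map size_iota ?size_drop ?sk ?addKn//.
by move=> j jk; rewrite (nth_map 0) ?size_iota// nth_iota// nth_drop.
Qed.

Lemma Rec_cons k F G : Rec k.+1 F -> Rec k G -> Rec k (fun s => F (G s :: s)).
Proof.
move=> rF rG; apply: (Rec_ext (F := fun s =>
    F [seq H s | H : seq nat -> nat <- G :: [seq (fun s => arg s j) | j <- iota 0 k]])).
  move=> s sk /=; congr (F (_ :: _)).
  by rewrite -map_comp (map_arg_iota (i := 0)) ?drop0.
apply: Rec_comp; rewrite /= size_map size_iota // => -[//|i]; rewrite ltnS /= => ik.
by rewrite (nth_map 0) ?size_iota//; exact: Rec_nth.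
Qed.

(** The recursion runs over a separate index of [h], for which [b s] is substituted afterwards; its
    depth may thus be any recursive function of the arguments. *)
Lemma Rec_prim k (h : nat -> seq nat -> nat) f g b :
    Rec k f -> Rec k.+2 g -> Rec k b ->
    (forall s, size s = k -> h 0 s = f s) ->
    (forall m s, size s = k -> h m.+1 s = g (m :: h m s :: s)) ->
  Rec k (fun s => h (b s) s).
Proof.
move=> rf rg rb h0 hS.
have rh : Rec k.+1 (fun s => h (arg s 0) (behead s)).
  by apply: (recursive_prim rf rg) => [v|m v] /=; rewrite ?h0 ?hS ?size_tuple.
exact: (Rec_cons rh rb).
Qed.

Lemma Rec_succ k F : Rec k F -> Rec k (fun s => (F s).+1).
Proof.
apply: (Rec_comp1 (f := succn)); apply: recursive_succ => v.
by rewrite /thead (tnth_nth 0).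
Qed.

Lemma Rec_add k F G : Rec k F -> Rec k G -> Rec k (fun s => F s + G s).
Proof.
move=> rF rG; apply: (@Rec_prim k (fun m s => m + G s) G (fun s => (arg s 1).+1) F) => //.
exact/Rec_succ/Rec_nth.
Qed.

Lemma Rec_mul k F G : Rec k F -> Rec k G -> Rec k (fun s => F s * G s).
Proof.
apply: (Rec_comp2 (f := muln)).
apply: (@Rec_prim 2 (fun m s => m * arg s 1) (fun=> 0)
  (fun s => arg s 3 + arg s 1) (fun s => arg s 0)) => //.
- exact: Rec_const.
- by apply: Rec_add; exact: Rec_nth.
- exact: Rec_nth.
Qed.

Lemma Rec_exp k F G : Rec k F -> Rec k G -> Rec k (fun s => F s ^ G s).
Proof.
apply: (Rec_comp2 (f := expn)).
apply: (@Rec_prim 2 (fun m s => arg s 0 ^ m) (fun=> 1)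
  (fun s => arg s 2 * arg s 1) (fun s => arg s 1)) => //.
- exact: Rec_const.
- by apply: Rec_mul; exact: Rec_nth.
- exact: Rec_nth.
- by move=> m s _; rewrite expnS.
Qed.

Lemma Rec_pred k F : Rec k F -> Rec k (fun s => (F s).-1).
Proof.
apply: (Rec_comp1 (f := predn)).
apply: (@Rec_prim 1 (fun m s => m.-1) (fun=> 0)
  (fun s => arg s 0) (fun s => arg s 0)) => //; try exact: Rec_nth.
exact: Rec_const.
Qed.

Lemma Rec_sub k F G : Rec k F -> Rec k G -> Rec k (fun s => F s - G s).
Proof.
apply: (Rec_comp2 (f := subn)).
apply: (@Rec_prim 2 (fun m s => arg s 0 - m) (fun s => arg s 0)
  (fun s => (arg s 1).-1) (fun s => arg s 1)) => //; try exact: Rec_nth.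
- exact/Rec_pred/Rec_nth.
- by move=> s _; rewrite subn0.
- by move=> m s _; rewrite subnS.
Qed.

Lemma Rec_leq k F G : Rec k F -> Rec k G -> Rec k (fun s => F s <= G s).
Proof.
move=> rF rG; apply: (Rec_ext (F := fun s => 1 - (F s - G s))).
  by move=> s _; rewrite -subn_eq0; case: (F s - G s).
by apply: Rec_sub (Rec_const _ 1) _; exact: Rec_sub.
Qed.

Lemma Rec_eq k F G : Rec k F -> Rec k G -> Rec k (fun s => F s == G s).
Proof.
move=> rF rG; apply: (Rec_ext (F := fun s => (F s <= G s) * (G s <= F s))).
  by move=> s _; rewrite mulnb eqn_leq.
by apply: Rec_mul; exact: Rec_leq.
Qed.

Lemma Rec_foldl_iota k (op : nat -> nat -> nat) F b x0 :
    Rec 2 (fun s => op (arg s 0) (arg s 1)) -> Rec k.+1 F -> Rec k b ->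
  Rec k (fun s => foldl (fun x m => op x (F (m :: s))) x0 (iota 0 (b s))).
Proof.
(* The step function receives [m :: x :: s] whereas [F] expects [m :: s]; the positions [js] skip
   the accumulator. *)
move=> rop rF rb; pose js := 0 :: iota 2 k.
apply: (@Rec_prim k (fun M s => foldl (fun x m => op x (F (m :: s))) x0 (iota 0 M))
  (fun=> x0) (fun s => op (arg s 1) (F [seq arg s j | j <- js]))) => //.
- exact: Rec_const.
- apply: Rec_comp2 rop _ _; first exact: Rec_nth.
  by apply: Rec_reindex rF; rewrite /= size_iota.
- move=> m s sk; rewrite -[m.+1]addn1 iotaD foldl_cat/= add0n.
  by rewrite (map_arg_iota (i := 2)) /= ?sk// drop0.
Qed.

Lemma Rec_sum k F b : Rec k.+1 F -> Rec k b ->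
  Rec k (fun s => \sum_(0 <= m < b s) F (m :: s)).
Proof.
move=> rF rb; have rD := Rec_add (Rec_nth 2 0) (Rec_nth 2 1).
apply: Rec_ext (Rec_foldl_iota 0 rD rF rb) => s _.
elim: (b s) => [|m IH]; first by rewrite big_nil.
by rewrite -[m.+1]addn1 iotaD foldl_cat IH addn1 big_nat_recr.
Qed.

Lemma Rec_prod k F b : Rec k.+1 F -> Rec k b ->
  Rec k (fun s => \prod_(0 <= m < b s) F (m :: s)).
Proof.
move=> rF rb; have rM := Rec_mul (Rec_nth 2 0) (Rec_nth 2 1).
apply: Rec_ext (Rec_foldl_iota 1 rM rF rb) => s _.
elim: (b s) => [|m IH]; first by rewrite big_nil.
by rewrite -[m.+1]addn1 iotaD foldl_cat IH addn1 big_nat_recr.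
Qed.

Lemma sum_ltn_const q M : \sum_(0 <= m < M) (m < q) = minn q M.
Proof.
elim: M => [|M IH]; first by rewrite big_nil minn0.
rewrite big_nat_recr//= IH; lia.
Qed.

Lemma Rec_div k F G : Rec k F -> Rec k G -> Rec k (fun s => F s %/ G s).
Proof.
apply: (Rec_comp2 (f := divn)).
(* The quotient counts the positive multiples of the divisor up to the dividend; the first factor
   gives [0] for the divisor [0]. *)
apply: (Rec_ext (F := fun s =>
    (0 < arg s 1) * \sum_(0 <= m < arg s 0) (m.+1 * arg s 1 <= arg s 0))).
  move=> s _; case: (posnP (arg s 1)) => [->|G0]; first by rewrite divn0.
  rewrite mul1n; under eq_bigr do rewrite -leq_divRL//.
  by rewrite sum_ltn_const; apply/minn_idPl/leq_div.
apply: Rec_mul; first by apply: Rec_leq; [exact: Rec_const|exact: Rec_nth].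
apply: (Rec_sum (F := fun s => (arg s 0).+1 * arg s 2 <= arg s 1)); last exact: Rec_nth.
by apply: Rec_leq; [apply: Rec_mul; [apply/Rec_succ|]|]; exact: Rec_nth.
Qed.

Lemma Rec_trunc_log2 k F : Rec k F -> Rec k (fun s => trunc_log 2 (F s)).
Proof.
apply: (Rec_comp1 (f := trunc_log 2)).
(* The logarithm counts the positive exponents whose power of 2 does not exceed the argument. *)
apply: (Rec_ext (F := fun s => \sum_(0 <= m < arg s 0) (2 ^ m.+1 <= arg s 0))).
  move=> s _; case: (posnP (arg s 0)) => [->|G0]; first by rewrite big_nil.
  have E m : (2 ^ m.+1 <= arg s 0) = (m < trunc_log 2 (arg s 0)).
    apply/idP/idP => [|mlt]; first exact: trunc_log_max.
    by rewrite (leq_trans _ (@trunc_logP 2 _ isT G0))// leq_pexp2l.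
  under eq_bigr do rewrite E.
  rewrite sum_ltn_const; apply/minn_idPl.
  by rewrite (leq_trans _ (@trunc_logP 2 _ isT G0))// ltnW// ltn_expl.
apply: (Rec_sum (F := fun s => 2 ^ (arg s 0).+1 <= arg s 1)); last exact: Rec_nth.
apply: Rec_leq; last exact: Rec_nth.
by apply: Rec_exp; [exact: Rec_const|apply/Rec_succ; exact: Rec_nth].
Qed.

Lemma Rec_odd k F : Rec k F -> Rec k (fun s => odd (F s)).
Proof.
apply: (Rec_comp1 (f := fun n => odd n)).
apply: (@Rec_prim 1 (fun m s => odd m) (fun=> 0)
  (fun s => 1 - arg s 1) (fun s => arg s 0)) => //; try exact: Rec_nth.
- exact: Rec_const.
- by apply: Rec_sub; [exact: Rec_const|exact: Rec_nth].
- by move=> m s _ /=; case: (odd m).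
Qed.

(** * The potential argument *)

Section Diagonal.
Variables (n : nat) (y0 : bits n) (f : nat -> bits n -> bits n -> nat).

(* [f t x y / 4 ^ t] is meant to increase to J(x,y).  All quantities below are
   numerators: the denominator is [4 ^ t] for [mass], [(4 ^ n) ^ t] for [numer]
   and [denom], and [scale ^ t] for [potential], [level] and [reward]. *)
Definition mass (t : nat) (u v : seq bool) : nat :=
  \sum_(x : bits n | prefix u x) \sum_(y : bits n | prefix v y) f t x y.

Definition numer (t : nat) (x : seq bool) : nat :=
  \prod_(i < n) mass t (take i.+1 x) (take i y0).

Definition denom (t : nat) (x : seq bool) : nat :=
  \prod_(i < n) mass t (take i x) (take i y0).

Definition potential (t : nat) : nat := \prod_(x : bits n) numer t x.

(* The factor is needed because [trunc_log 2 0 = 0]. *)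
Definition level (t : nat) : nat :=
  (0 < potential t) * 2 ^ trunc_log 2 (potential t).

Definition next_bit (t : nat) (u : seq bool) : bool :=
  mass t (rcons u true) (take (size u) y0) <
  mass t (rcons u false) (take (size u) y0).

Definition greedy (t : nat) (x : seq bool) : bool :=
  [forall i : 'I_n, nth false x i == next_bit t (take i x)].

Definition scale : nat := (4 ^ n) ^ (2 ^ n).

Fixpoint reward (t : nat) (x : seq bool) : nat :=
  if t is t'.+1
  then scale * reward t' x + greedy t x * (level t - scale * level t')
  else 0.

Lemma mass_split t (u v : seq bool) : size u < n ->
  mass t u v = mass t (rcons u false) v + mass t (rcons u true) v.
Proof.
move=> un; rewrite /mass.
rewrite (bigID (fun x : bits n => nth false x (size u)))/= addnC.
have E x b : prefix (rcons u b) (x : bits n) =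
    prefix u x && (nth false x (size u) == b).
  have ux : size u < size x by rewrite size_tuple.
  rewrite !prefixE size_rcons (take_nth false)// eqseq_rcons.
  by [].
congr (_ + _); apply: eq_bigl => x; rewrite E; congr (_ && _).
  by case: nth.
by case: nth.
Qed.

(** The mass of a prefix splits between its two extensions and the greedy bit takes the smaller
    share, so each of the [n] steps gives a factor 2. *)
Lemma greedy_denom t x : size x = n -> greedy t x ->
  2 ^ n * numer t x <= denom t x.
Proof.
move=> xn /forallP gx.
have -> : 2 ^ n = \prod_(i < n) 2 by rewrite prod_nat_const card_ord.
rewrite /numer /denom -big_split/=; apply: leq_prod => i _.
have ix : i < size x by rewrite xn.
rewrite (@mass_split t (take i x)) ?size_take ?ix//.
rewrite (take_nth false ix).
have /eqP -> := gx i; rewrite /next_bit size_take ix.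
by case: ltnP => h /=; rewrite mul2n -addnn ?leq_add2l ?leq_add2r // ltnW.
Qed.

Lemma greedy_inj t x x' : size x = n -> size x' = n ->
  greedy t x -> greedy t x' -> x = x'.
Proof.
move=> xn x'n /forallP gx /forallP gx'.
have E i : i <= n -> take i x = take i x'.
  elim: i => [|i IH] iN; first by rewrite !take0.
  rewrite !(take_nth false) ?xn ?x'n//.
  have /eqP-> := gx (Ordinal iN); have /eqP-> := gx' (Ordinal iN).
  by rewrite /= IH// ltnW.
by rewrite -(take_size x) -(take_size x') xn x'n E.
Qed.

Lemma greedy_exists t : exists x : bits n, greedy t x.
Proof.
pose g i := iter i (fun u => rcons u (next_bit t u)) [::].
have sg i : size (g i) = i by elim: i => //= i IH; rewrite size_rcons IH.
have tg i j : i <= j -> take i (g j) = g i.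
  elim: j => [|j IH]; first by rewrite leqn0 => /eqP ->.
  rewrite leq_eqVlt => /predU1P[->|]; first by rewrite -[X in take X _](sg j.+1) take_size.
  rewrite ltnS => ij; rewrite /= -cats1 take_cat sg.
  case: ltnP => // ji; first by rewrite IH.
  by have -> : i = j by [lia]; rewrite subnn cats0.
have gn : size (g n) == n by rewrite sg.
exists (Tuple gn); apply/forallP => i /=; rewrite tg ?(ltnW (ltn_ord i))//.
by rewrite -(nth_take false (ltnSn i)) tg//= nth_rcons sg ltnn eqxx.
Qed.

(** Exactly one string of length [n] is greedy at a given time, so an increment is paid out exactly
    once. *)
Lemma sum_greedy t (w : nat) : \sum_(x : bits n) greedy t x * w = w.
Proof.
have [z gz] := greedy_exists t.
rewrite (bigD1 z)//= gz mul1n big1 ?addn0// => x xz.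
case gx: (greedy t x); last by rewrite mul0n.
by case/eqP: xz; apply/val_inj/(greedy_inj _ _ gx gz); rewrite size_tuple.
Qed.

Hypothesis f_mono : forall t x y, 4 * f t x y <= f t.+1 x y.

Lemma mass_mono t u v : 4 * mass t u v <= mass t.+1 u v.
Proof.
rewrite /mass big_distrr/=; apply: leq_sum => x _.
by rewrite big_distrr/=; apply: leq_sum.
Qed.

Lemma numer_mono t x : 4 ^ n * numer t x <= numer t.+1 x.
Proof.
have -> : 4 ^ n = \prod_(i < n) 4 by rewrite prod_nat_const card_ord.
by rewrite -big_split/=; apply: leq_prod => i _; exact: mass_mono.
Qed.

Lemma potential_mono t : scale * potential t <= potential t.+1.
Proof.
have -> : scale = \prod_(x : bits n) 4 ^ n.
  by rewrite prod_nat_const card_tuple card_bool.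
by rewrite -big_split/=; apply: leq_prod => x _; exact: numer_mono.
Qed.

Lemma scale_pow2 : scale = 2 ^ (2 * n * 2 ^ n).
Proof. by rewrite /scale -[4]/(2 ^ 2) -!expnM mulnA. Qed.

Lemma scale_gt0 : 0 < scale. Proof. by rewrite scale_pow2 expn_gt0. Qed.

Lemma level_le t : level t <= potential t.
Proof.
by rewrite /level; case: posnP => [_|p0]; rewrite ?mul0n// mul1n trunc_logP.
Qed.

Lemma level_gt t : 0 < potential t -> potential t < 2 * level t.
Proof. by rewrite /level => p0; rewrite p0 mul1n -expnS; exact: trunc_log_ltn. Qed.

(** As [scale] is a power of 2, rounding down to a power of 2 commutes with multiplication by it,
    and the growth of [potential] passes to [level]. *)
Lemma level_mono t : scale * level t <= level t.+1.
Proof.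
rewrite {1}/level; case: posnP => [_|p0]; first by rewrite mul0n muln0.
have sp : scale * 2 ^ trunc_log 2 (potential t) <= potential t.+1.
  by apply: leq_trans (potential_mono t); rewrite leq_mul2l trunc_logP ?orbT.
have p1 : 0 < potential t.+1 by apply: leq_trans sp; rewrite muln_gt0 scale_gt0 expn_gt0.
rewrite /level p1 !mul1n; move: sp; rewrite scale_pow2 -expnD => sp.
by rewrite leq_pexp2l// trunc_log_max.
Qed.

(** The increments telescope; by [level_mono] the truncated subtractions in [reward] lose
    nothing. *)
Lemma sum_reward_le t : \sum_(x : bits n) reward t x <= level t.
Proof.
elim: t => [|t IH]; first by rewrite big1.
rewrite big_split/= -big_distrr/= sum_greedy.
by apply: leq_trans (leq_add (leq_mul (leqnn _) IH) (leqnn _)) _; rewrite subnKC ?level_mono.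
Qed.

Lemma reward_mono t x : scale * reward t x <= reward t.+1 x.
Proof. exact: leq_addr. Qed.

Hypothesis f_le : forall t, \sum_(x : bits n) \sum_(y : bits n) f t x y <= 4 ^ t.

Lemma mass_le t u v : mass t u v <= 4 ^ t.
Proof.
apply: leq_trans (f_le t).
rewrite /mass big_mkcond/=; apply: leq_sum => x _; case: ifP => // _.
by rewrite big_mkcond/=; apply: leq_sum => y _; case: ifP.
Qed.

Lemma potential_le t : potential t <= scale ^ t.
Proof.
have -> : scale ^ t = \prod_(x : bits n) \prod_(i < n) 4 ^ t.
  rewrite !prod_nat_const card_tuple card_bool card_ord /scale -!expnM.
  by congr (_ ^ _); lia.
by apply: leq_prod => x _; apply: leq_prod => i _; exact: mass_le.
Qed.

Hypothesis f0 : forall x y, f 0 x y = 0.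

(* The level at time [t] is [2 ^ - j_t]; take the minimal [j_t] and the first
   time [s] at which it is attained. *)
Lemma last_jump : 0 < n -> (exists t, 0 < potential t) ->
  exists s j (z : bits n), [/\ greedy s z, scale ^ s <= 2 ^ j * potential s,
    forall t, 2 ^ j * potential t <= 2 * scale ^ t,
    forall t, 2 ^ j * \sum_(x : bits n) reward t x <= scale ^ t &
    scale ^ s <= 2 * 2 ^ j * reward s z].
Proof.
move=> n0 [t0 pt0].
(* Both a nonzero level and [scale ^ t] are powers of 2, and [potential_le] makes the difference of
   their exponents nonnegative. *)
have lev t : 0 < potential t -> exists j, 2 ^ j * level t == scale ^ t.
  move=> p0; exists (2 * n * 2 ^ n * t - trunc_log 2 (potential t)).
  rewrite /level p0 mul1n -expnD scale_pow2 -expnM subnK//.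
  rewrite -(@leq_exp2l 2)//; apply: leq_trans (trunc_logP _ _) _ => //.
  by rewrite expnM -scale_pow2 potential_le.
have ex_j : exists j, `[<exists t, 2 ^ j * level t = scale ^ t>].
  by have [j /eqP jt] := lev _ pt0; exists j; apply/asboolP; exists t0.
case: (ex_minnP ex_j) => j /asboolP[t1 jt1] jmin.
have ex_s : exists s, 2 ^ j * level s == scale ^ s by exists t1; apply/eqP.
case: (ex_minnP ex_s) => s /eqP js smin.
have [z gz] := greedy_exists s.
have lev_le t : 2 ^ j * level t <= scale ^ t.
  case: (posnP (potential t)) => [p0|p0].
    by rewrite /level p0 ltnn mul0n muln0.
  have [j' /eqP jt] := lev t p0.
  have jj' : j <= j' by apply: jmin; apply/asboolP; exists t.
  by rewrite -jt leq_mul2r leq_pexp2l ?orbT.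
exists s, j, z; split => //.
- by rewrite -js leq_mul2l level_le orbT.
- move=> t; case: (posnP (potential t)) => [->|p0]; first by rewrite muln0.
  apply: leq_trans (leq_mul (leqnn _) (ltnW (level_gt p0))) _.
  by rewrite mulnCA leq_mul2l lev_le.
- by move=> t; apply: leq_trans (lev_le t); rewrite leq_mul2l sum_reward_le orbT.
(* The jump cannot happen at time 0: by [f0] all masses vanish there, and since [0 < n] the products
   are not empty, so the level is 0. *)
case: s js smin gz => [|s] js smin gz.
  move: js; rewrite /level /potential /numer.
  have [z0 _] := greedy_exists 0.
  rewrite (bigD1 z0)//= (bigD1 (Ordinal n0))//= /mass.
  by rewrite big1 ?mul0n ?muln0// => x _; rewrite big1.
(* Just before the first time at which [j] is attained, the exponent is strictly larger or the
   potential is 0. The normalized level at least doubles, so the jump pays at least half of the new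
   level. *)
have half : 2 * (2 ^ j * level s) <= scale ^ s.
  case: (posnP (potential s)) => [p0|p0].
    by rewrite /level p0 ltnn mul0n !muln0.
  have [j' /eqP jt] := lev s p0.
  have jj' : j <= j' by apply: jmin; apply/asboolP; exists s.
  rewrite -jt mulnA -expnS leq_mul2r leq_pexp2l ?orbT//.
  rewrite ltn_neqAle jj' andbT; apply: contraTneq (ltnSn s) => jE.
  by rewrite -leqNgt smin// jE jt.
rewrite /= gz mul1n; move: half js (level_mono s); rewrite expnS => half js lm.
have : scale * (2 * (2 ^ j * level s)) <= scale * scale ^ s by rewrite leq_mul2l half orbT.
nia.
Qed.

End Diagonal.

(** * Binary codes *)

Lemma bits_code_rcons s b : bits_code (rcons s b) = (bits_code s).*2 + b.
Proof. by rewrite /bits_code -cats1 foldl_cat. Qed.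

Lemma bits_code_bounds s : 2 ^ size s <= bits_code s < 2 ^ (size s).+1.
Proof.
elim/last_ind: s => [//|s b]; rewrite bits_code_rcons size_rcons !expnS.
case: b; lia.
Qed.

Lemma bits_code_take s i : i <= size s ->
  bits_code (take i s) = bits_code s %/ 2 ^ (size s - i).
Proof.
elim/last_ind: s => [|s b IH]; first by rewrite leqn0 => /eqP->.
rewrite size_rcons leq_eqVlt ltnS => /predU1P[->|iS].
  by rewrite -(size_rcons s b) take_size subnn divn1.
rewrite -cats1 takel_cat// IH// cats1 bits_code_rcons subSn// expnS divnMA divn2.
by case: b; rewrite ?addn1 ?addn0 /= ?uphalf_double ?doubleK.
Qed.

Lemma bits_code_inj s s' : size s = size s' -> bits_code s = bits_code s' -> s = s'.
Proof.
elim/last_ind: s s' => [|s b IH] s'; first by case: s'.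
elim/last_ind: s' => [|s' b' _]; first by rewrite size_rcons.
rewrite !size_rcons !bits_code_rcons => -[ss] E.
have /IH-> // : bits_code s = bits_code s'.
  by move: E; case: b; case: b'; lia.
by congr rcons; move: E; case: b; case: b'; lia.
Qed.

Lemma bits_code_nseq n : bits_code (nseq n false) = 2 ^ n.
Proof.
elim: n => // n IH.
by rewrite -addn1 nseqD cats1 bits_code_rcons IH addn0 addn1 expnS mul2n.
Qed.

Lemma trunc_log_bits_code n (x : bits n) : trunc_log 2 (bits_code x) = n.
Proof. by apply: trunc_log_eq => //; have := bits_code_bounds x; rewrite size_tuple. Qed.

Lemma prefix_bits_code n (u : seq bool) (x : bits n) : size u <= n ->
  prefix u x = (bits_code x %/ 2 ^ (n - size u) == bits_code u).
Proof.
move=> un; have := @bits_code_take x (size u).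
rewrite size_tuple => /(_ un) <-; rewrite prefixE; apply/eqP/eqP => [->//|].
by apply: bits_code_inj; rewrite size_take size_tuple; case: ltnP un => //; lia.
Qed.


Section BigBits.
Variables (idx : nat) (op : Monoid.com_law idx) (n : nat).

(** Codes of strings of length [n] lie in an interval of [2 ^ n] numbers, and an injection between
    finite sets of equal size is onto. *)
Lemma big_bits_code (F : nat -> nat) :
  \big[op/idx]_(x : bits n) F (bits_code x) =
  \big[op/idx]_(0 <= a < 2 ^ n) F (2 ^ n + a).
Proof.
have ge2 (x : bits n) : 2 ^ n <= bits_code x.
  by have := bits_code_bounds x; rewrite size_tuple => /andP[].
have lt2 (x : bits n) : bits_code x - 2 ^ n < 2 ^ n.
  have := bits_code_bounds x; rewrite size_tuple expnS; lia.
pose h (x : bits n) := Ordinal (lt2 x).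
have h_inj : injective h.
  move=> x x' /(congr1 (fun i : 'I__ => i + 2 ^ n)) /=; rewrite !subnK// => E.
  by apply/val_inj/bits_code_inj; rewrite ?size_tuple.
have h_bij : bijective h.
  by apply: inj_card_bij h_inj _; rewrite card_ord card_tuple card_bool.
rewrite big_mkord (reindex h)/=; last exact: onW_bij.
by apply: eq_bigr => x _; rewrite subnKC ?ge2.
Qed.
End BigBits.

Definition zeros n : bits n := nseq_tuple n false.

(** * Arithmetic form of the construction, on codes of strings *)

Section CodedReward.
Variable A : nat -> nat -> nat -> nat.

Definition approx n (t : nat) (x y : bits n) := A t (bits_code x) (bits_code y).

(* Since 1s is the binary expansion of the code of s, [a + 2 ^ n] runs over the
   codes of strings of length [n], and the code of the prefix of length [i] is
   the quotient by [2 ^ (n - i)]; the code of [0^j] is [2 ^ j]. *)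
Definition mass_code t n i j u :=
  \sum_(0 <= a < 2 ^ n) \sum_(0 <= b < 2 ^ n)
    ((2 ^ n + a) %/ 2 ^ (n - i) == u) * (((2 ^ n + b) %/ 2 ^ (n - j) == 2 ^ j) *
    A t (2 ^ n + a) (2 ^ n + b)).

Lemma mass_codeE n t u j : size u <= n -> j <= n ->
  mass (@approx n) t u (take j (zeros n)) = mass_code t n (size u) j (bits_code u).
Proof.
move=> un jn; rewrite /mass /mass_code big_mkcond/=.
pose F a := \sum_(0 <= b < 2 ^ n)
    (a %/ 2 ^ (n - size u) == bits_code u) * (((2 ^ n + b) %/ 2 ^ (n - j) == 2 ^ j) *
    A t a (2 ^ n + b)).
rewrite -[RHS](big_bits_code _ n F); apply: eq_bigr => x _.
rewrite /F -big_distrr/= -prefix_bits_code//.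
case: prefix; rewrite ?mul0n// mul1n big_mkcond/=.
pose G b := (b %/ 2 ^ (n - j) == 2 ^ j) * A t (bits_code x) b.
rewrite -[RHS](big_bits_code _ n G); apply: eq_bigr => y _.
rewrite /G take_nseq// prefix_bits_code ?size_nseq// bits_code_nseq.
by case: eqP => _; rewrite ?mul1n ?mul0n.
Qed.

Definition numer_code t n z :=
  \prod_(0 <= i < n) mass_code t n i.+1 i (z %/ 2 ^ (n - i.+1)).

Lemma numer_codeE n t (x : bits n) :
  numer (zeros n) (@approx n) t x = numer_code t n (bits_code x).
Proof.
rewrite /numer /numer_code big_mkord; apply: eq_bigr => i _.
have iN : i.+1 <= size x by rewrite size_tuple.
have si : size (take i.+1 x) = i.+1 by rewrite size_takel.
rewrite mass_codeE ?si//; last exact/ltnW.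
by rewrite bits_code_take// size_tuple.
Qed.

Definition level_code t n :=
  let p := \prod_(0 <= a < 2 ^ n) numer_code t n (2 ^ n + a) in
  (0 < p) * 2 ^ trunc_log 2 p.

Lemma level_codeE n t : level (zeros n) (@approx n) t = level_code t n.
Proof.
rewrite /level /level_code.
suff -> : potential (zeros n) (@approx n) t =
  \prod_(0 <= a < 2 ^ n) numer_code t n (2 ^ n + a) by [].
by rewrite -(big_bits_code _ n (numer_code t n)); apply: eq_bigr => x _; exact: numer_codeE.
Qed.

(** The quantifier over positions becomes a product of truth values; the extensions of a prefix with
    code [c] have the codes [2 * c] and [(2 * c).+1]. *)
Definition greedy_code t n z :=
  \prod_(0 <= i < n) ((odd (z %/ 2 ^ (n - i.+1)) : nat) ==
    (mass_code t n i.+1 i (2 * (z %/ 2 ^ (n - i))).+1 <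
     mass_code t n i.+1 i (2 * (z %/ 2 ^ (n - i))))).

Lemma greedy_codeE n t (x : bits n) :
  greedy (zeros n) (@approx n) t x = greedy_code t n (bits_code x) :> nat.
Proof.
have E (i : 'I_n) : (nth false x i == next_bit (zeros n) (@approx n) t (take i x)) =
    ((odd (bits_code x %/ 2 ^ (n - i.+1)) : nat) ==
    (mass_code t n i.+1 i (2 * (bits_code x %/ 2 ^ (n - i))).+1 <
     mass_code t n i.+1 i (2 * (bits_code x %/ 2 ^ (n - i))))).
  have iN : i < size x by rewrite size_tuple.
  have si : size (take i x) = i by rewrite size_takel// ltnW.
  have tE j : j <= n -> bits_code x %/ 2 ^ (n - j) = bits_code (take j x).
    by move=> jn; rewrite bits_code_take size_tuple.
  rewrite !tE//; last exact/ltnW.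
  rewrite (take_nth false)// /next_bit.
  rewrite !mass_codeE ?size_rcons ?si//; try exact/ltnW.
  rewrite !bits_code_rcons mul2n addn0 addn1.
  rewrite oddD odd_double addFb oddb.
  by case: nth; case: (_ < _).
rewrite /greedy_code big_mkord /greedy.
case: forallP => [H|H].
  by rewrite big1// => i _; rewrite -E H.
have [i Hi] : exists i : 'I_n,
    ~~ (nth false x i == next_bit (zeros n) (@approx n) t (take i x)).
  by apply/existsP; apply: contra_notT H => /existsPn H i; have := H i; rewrite negbK.
by rewrite (bigD1 i)//= -E (negbTE Hi) mul0n.
Qed.

Fixpoint reward_code t n z := if t is t'.+1 then
  (4 ^ n) ^ (2 ^ n) * reward_code t' n z +
    greedy_code t n z * (level_code t n - (4 ^ n) ^ (2 ^ n) * level_code t' n)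
  else 0.

Lemma reward_codeE n t (x : bits n) :
  reward (zeros n) (@approx n) t x = reward_code t n (bits_code x).
Proof. by elim: t => //= t ->; rewrite greedy_codeE !level_codeE. Qed.

End CodedReward.

(** * Recursiveness of the coded reward *)

Ltac rec_arith := repeat first
  [ exact: Rec_nth | exact: Rec_const | apply: Rec_eq | apply: Rec_leq
  | apply: Rec_succ | apply: Rec_mul | apply: Rec_add | apply: Rec_sub
  | apply: Rec_exp | apply: Rec_div | apply: Rec_odd | apply: Rec_trunc_log2 ].

Section RecursiveReward.
Variable A : nat -> nat -> nat -> nat.
Hypothesis recA : Rec 3 (fun s => A (arg s 0) (arg s 1) (arg s 2)).

Lemma Rec_mass_code :
  Rec 5 (fun s => mass_code A (arg s 0) (arg s 1) (arg s 2) (arg s 3) (arg s 4)).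
Proof.
apply: (@Rec_sum _ (fun s => \sum_(0 <= b < 2 ^ arg s 2)
    ((2 ^ arg s 2 + arg s 0) %/ 2 ^ (arg s 2 - arg s 3) == arg s 5) *
    (((2 ^ arg s 2 + b) %/ 2 ^ (arg s 2 - arg s 4) == 2 ^ arg s 4) *
    A (arg s 1) (2 ^ arg s 2 + arg s 0) (2 ^ arg s 2 + b)))); last by rec_arith.
(* Both bound variables are now in front, [b] at position 0 and [a] at 1, so [t], [n], [i], [j], [u]
   sit at positions 2 to 6. *)
apply: (@Rec_sum _ (fun s =>
    ((2 ^ arg s 3 + arg s 1) %/ 2 ^ (arg s 3 - arg s 4) == arg s 6) *
    (((2 ^ arg s 3 + arg s 0) %/ 2 ^ (arg s 3 - arg s 5) == 2 ^ arg s 5) *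
    A (arg s 2) (2 ^ arg s 3 + arg s 1) (2 ^ arg s 3 + arg s 0)))); last by rec_arith.
by rec_arith; apply: (Rec_comp3 recA); rec_arith.
Qed.

Lemma Rec_numer_code : Rec 3 (fun s => numer_code A (arg s 0) (arg s 1) (arg s 2)).
Proof.
apply: (@Rec_prod _ (fun s => mass_code A (arg s 1) (arg s 2) (arg s 0).+1
  (arg s 0) (arg s 3 %/ 2 ^ (arg s 2 - (arg s 0).+1)))); last by rec_arith.
by apply: (Rec_comp5 Rec_mass_code); rec_arith.
Qed.

Lemma Rec_level_code : Rec 2 (fun s => level_code A (arg s 0) (arg s 1)).
Proof.
have rp : Rec 2 (fun s =>
    \prod_(0 <= a < 2 ^ arg s 1) numer_code A (arg s 0) (arg s 1) (2 ^ arg s 1 + a)).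
  apply: (@Rec_prod _ (fun s =>
    numer_code A (arg s 1) (arg s 2) (2 ^ arg s 2 + arg s 0))); last by rec_arith.
  by apply: (Rec_comp3 Rec_numer_code); rec_arith.
by rewrite /level_code; rec_arith.
Qed.

Lemma Rec_greedy_code : Rec 3 (fun s => greedy_code A (arg s 0) (arg s 1) (arg s 2)).
Proof.
apply: (@Rec_prod _ (fun s =>
    (odd (arg s 3 %/ 2 ^ (arg s 2 - (arg s 0).+1)) : nat) ==
    (mass_code A (arg s 1) (arg s 2) (arg s 0).+1 (arg s 0)
       (2 * (arg s 3 %/ 2 ^ (arg s 2 - arg s 0))).+1 <
     mass_code A (arg s 1) (arg s 2) (arg s 0).+1 (arg s 0)
       (2 * (arg s 3 %/ 2 ^ (arg s 2 - arg s 0)))))); last by rec_arith.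
by rec_arith; apply: (Rec_comp5 Rec_mass_code); rec_arith.
Qed.

Lemma Rec_reward_code : Rec 3 (fun s => reward_code A (arg s 0) (arg s 1) (arg s 2)).
Proof.
(* In the step function, position 0 is the time, 1 the previous reward, 3 the length and 4 the code;
   position 2 holds the original time argument. *)
apply: (@Rec_prim 3 (fun t s => reward_code A t (arg s 1) (arg s 2)) (fun=> 0)
  (fun s => (4 ^ arg s 3) ^ (2 ^ arg s 3) * arg s 1 +
     greedy_code A (arg s 0).+1 (arg s 3) (arg s 4) *
     (level_code A (arg s 0).+1 (arg s 3) -
      (4 ^ arg s 3) ^ (2 ^ arg s 3) * level_code A (arg s 0) (arg s 3)))
  (fun s => arg s 0)) => //; [exact: Rec_const| |exact: Rec_nth].
apply: Rec_add; first by rec_arith.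
apply: Rec_mul; first by apply: (Rec_comp3 Rec_greedy_code); rec_arith.
apply: Rec_sub; first by apply: (Rec_comp2 Rec_level_code); rec_arith.
apply: Rec_mul; first by rec_arith.
by apply: (Rec_comp2 Rec_level_code); rec_arith.
Qed.
End RecursiveReward.

(** * Dyadic approximation of enumerable functions *)

Local Open Scope ring_scope.

Section DyadicApproximation.
Variable R : realType.

(** Fixing the denominator [2 ^ t] lets all later comparisons take place in [nat], where being
    nondecreasing reads [2 * A t <= A t.+1]. *)
Definition dyadic_approx (A : nat -> nat) (l : R) : Prop :=
  [/\ A 0%N = 0%N, forall t, (2 * A t <= A t.+1)%N,
      forall t, (A t)%:R / (2 ^ t)%:R <= l &
      (fun t => (A t)%:R / (2 ^ t)%:R : R) @ \oo --> l].

(* Truncated subtraction takes the positive part, and the first factor makes the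
   approximation start at [0], so that the first level is a jump as well. *)
Definition dyadic_floor (a b d t : nat) : nat :=
  ((0 < t) * (((a - b) * 2 ^ t) %/ d.+1))%N.

(** Rounding down to multiples of [1 / 2 ^ t] keeps a sequence nondecreasing, since these are also
    multiples of [1 / 2 ^ t.+1], and the rounding error tends to 0. *)
Lemma dyadic_floorP (a b d : nat -> nat) (u : nat -> rat) (l : R) :
    (forall t, u t = ((a t)%:R - (b t)%:R) / (d t).+1%:R) ->
    nondecreasing_seq u -> (fun t => ratr (u t) : R) @ \oo --> l -> 0 <= l ->
  dyadic_approx (fun t => dyadic_floor (a t) (b t) (d t) t) l.
Proof.
move=> uE umono ul l0.
pose v t := ((a t)%:R - (b t)%:R) / (d t).+1%:R : R.
have vE t : ratr (u t) = v t.
  by rewrite uE rmorphM rmorphB/= fmorphV/= !ratr_nat.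
have vl : v @ \oo --> l by under eq_cvg do rewrite -vE.
have vmono : nondecreasing_seq v.
  by move=> s t st; rewrite -!vE ler_rat umono.
have v_le t : v t <= l.
  by rewrite -(cvg_lim _ vl)//; apply: nondecreasing_cvgn_le => //; apply/cvg_ex; exists l.
have up t : (dyadic_floor (a t) (b t) (d t) t)%:R / (2 ^ t)%:R <= l.
  rewrite /dyadic_floor; case: ltnP => _; last by rewrite mul0n mul0r.
  rewrite mul1n ler_pdivrMr ?ltr0n ?expn_gt0//.
  (* When the given rational is not positive the approximation is 0, and [0 <= l] bounds it. *)
  case: (leqP (a t) (b t)) => ab.
    by rewrite (eqP ab) mul0n div0n mulr_ge0.
  apply: le_trans (_ : v t * (2 ^ t)%:R <= _); last by rewrite ler_wpM2r.
  rewrite /v -natrB ?(ltnW ab)// mulrAC -natrM ler_pdivlMr ?ltr0n//.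
  by rewrite -natrM ler_nat leq_trunc_div.
split => //.
- move=> t; rewrite /dyadic_floor; case: t => [|t]; first by rewrite muln0.
  rewrite !mul1n leq_divRL//.
  set e := (a t.+1 - b t.+1)%N; set e' := (a t.+2 - b t.+2)%N.
  set m := (_ %/ _)%N.
  (* Cross-multiplied monotonicity, for the positive parts of the numerators. *)
  have ee' : (e * (d t.+2).+1 <= e' * (d t.+1).+1)%N.
    have := vmono t.+1 t.+2 (leqnSn _).
    rewrite /v ler_pdivrMr ?ltr0n// mulrAC ler_pdivlMr ?ltr0n// /e /e'.
    case: (leqP (a t.+1) (b t.+1)) => [ab _|ab]; first by rewrite (eqP ab).
    rewrite -natrB ?(ltnW ab)//.
    case: (leqP (a t.+2) (b t.+2)) => [ab'|ab'].
      rewrite leNgt => /negP[]; apply: le_lt_trans (_ : _ <= 0) _.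
        by rewrite mulr_le0_ge0// subr_le0 ler_nat.
      by rewrite mulr_gt0// ?ltr0n// subn_gt0.
    by rewrite -natrB ?(ltnW ab')// -!natrM ler_nat.
  have md : (m * (d t.+1).+1 <= e * 2 ^ t.+1)%N by exact: leq_trunc_div.
  rewrite -(leq_pmul2r (ltn0Sn (d t.+1))) [(2 ^ t.+2)%N]expnS.
  move: (leq_mul md (leqnn (2 * (d t.+2).+1)))%N (leq_mul ee' (leqnn (2 * 2 ^ t.+1)))%N.
  set D := (d t.+1).+1; set D' := (d t.+2).+1; set K := (2 ^ t.+1)%N => h1 h2.
  nia.
(* The rounding error is at most [1 / 2 ^ t]; time 0 is left out because the value there was forced
   to 0. *)
- apply: (squeeze_cvgr (f := fun t => v t - (2 ^ t)%:R^-1) (h := cst l)) => //.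
  + exists 1%N => // t /= t0; rewrite up andbT /dyadic_floor t0 mul1n.
    rewrite lerBlDr -[X in _ + X]mul1r -mulrDl ler_pdivlMr ?ltr0n ?expn_gt0//.
    rewrite natr1 /v mulrAC ler_pdivrMr ?ltr0n// -natrM.
    apply: le_trans (_ : ((a t - b t) * 2 ^ t)%:R <= _); last first.
      by rewrite ler_nat ltnW// ltn_ceil.
    rewrite natrM ler_wpM2r// lerBlDr -natrD ler_nat.
    lia.
  + rewrite -[X in _ --> X]subr0; apply: cvgB => //.
    rewrite (_ : (fun t => _) = (GRing.exp (2^-1 : R))); last first.
      by apply/funext => t; rewrite natrX exprVn.
    by apply: cvg_expr; rewrite ger0_norm ?invr_ge0// invf_lt1// ltr1n.
  + exact: cvg_cst.
Qed.

Lemma Rec_dyadic_floor k F1 F2 F3 F4 : Rec k F1 -> Rec k F2 -> Rec k F3 -> Rec k F4 ->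
  Rec k (fun s => dyadic_floor (F1 s) (F2 s) (F3 s) (F4 s)).
Proof. by move=> *; rewrite /dyadic_floor; rec_arith. Qed.

Lemma recursive2_Rec (h : 2.-tuple nat -> nat) : recursive h ->
  Rec 2 (fun s => h [tuple arg s 0%N; arg s 1%N]).
Proof.
rewrite /Rec; congr recursive; apply/funext => v; congr h.
by apply/val_inj; case: v => -[|? [|? []]].
Qed.

Lemma recursive3_Rec (h : 3.-tuple nat -> nat) : recursive h ->
  Rec 3 (fun s => h [tuple arg s 0%N; arg s 1%N; arg s 2%N]).
Proof.
rewrite /Rec; congr recursive; apply/funext => v; congr h.
by apply/val_inj; case: v => -[|? [|? [|? []]]].
Qed.

Lemma enumerable1_dyadic (p : unifun R) :
    enumerable1 p -> (forall n y, 0 <= p n y) ->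
  exists2 B : nat -> nat -> nat, Rec 2 (fun s => B (arg s 0%N) (arg s 1%N)) &
    forall n (y : bits n), dyadic_approx (B ^~ (bits_code y)) (p n y).
Proof.
move=> [g [a [b [d [ra rb rd gE]]]] gp] p0.
exists (fun t y => dyadic_floor (a [tuple t; y]) (b [tuple t; y]) (d [tuple t; y]) t).
  by apply: Rec_dyadic_floor; [exact: recursive2_Rec ..|exact: Rec_nth].
move=> n y; have [gmono gl] := gp n y.
exact: (dyadic_floorP (fun t => gE _) gmono gl (p0 n y)).
Qed.

Lemma enumerable2_dyadic (P : bifun R) :
    enumerable2 P -> (forall n x y, 0 <= P n x y) ->
  exists2 A : nat -> nat -> nat -> nat,
    Rec 3 (fun s => A (arg s 0%N) (arg s 1%N) (arg s 2%N)) &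
    forall n (x y : bits n),
      dyadic_approx (fun t => A t (bits_code x) (bits_code y)) (P n x y).
Proof.
move=> [g [a [b [d [ra rb rd gE]]]] gP] P0.
exists (fun t x y =>
  dyadic_floor (a [tuple t; x; y]) (b [tuple t; x; y]) (d [tuple t; x; y]) t).
  by apply: Rec_dyadic_floor; [exact: recursive3_Rec ..|exact: Rec_nth].
move=> n x y; have [gmono gl] := gP n x y.
exact: (dyadic_floorP (fun t => gE _) gmono gl (P0 n x y)).
Qed.

(** This is the marginal to be paired with Q. The length of [y] is read off its code, and the
    predecessor fits the denominators [d.+1] of [computable_rat]. *)
Lemma enumerable1_uniform : enumerable1 (fun n _ => (2 ^ n)%:R^-1 : R).
Proof.
exists (fun v => 1 / ((2 ^ trunc_log 2 (arg v 1%N)).-1).+1%:R).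
  exists (fun=> 1%N), (fun=> 0%N), (fun v => (2 ^ trunc_log 2 (arg v 1%N)).-1); split.
  - exact: (Rec_const 2 1).
  - exact: (Rec_const 2 0).
  - have : Rec 2 (fun s => (2 ^ trunc_log 2 (arg s 1%N)).-1); last by [].
    by apply: Rec_pred; rec_arith.
  - by move=> v; rewrite subr0.
move=> n y; split; first by move=> s t _ /=.
rewrite /= trunc_log_bits_code prednK ?expn_gt0//.
by rewrite fmorph_div/= rmorph1 ratr_nat div1r; exact: cvg_cst.
Qed.

End DyadicApproximation.

(** * Passage to the limit *)

Lemma cvg_sumr (R : realType) (I : Type) (r : seq I) (P : pred I)
    (F : I -> nat -> R) (l : I -> R) :
    (forall i, P i -> F i @ \oo --> l i) ->
  (fun t => \sum_(i <- r | P i) F i t) @ \oo --> \sum_(i <- r | P i) l i.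
Proof. by move=> Fl; apply: cvg_big => //; exact: add_continuous. Qed.

Lemma cvg_prodr (R : realType) (I : Type) (r : seq I) (P : pred I)
    (F : I -> nat -> R) (l : I -> R) :
    (forall i, P i -> F i @ \oo --> l i) ->
  (fun t => \prod_(i <- r | P i) F i t) @ \oo --> \prod_(i <- r | P i) l i.
Proof. by move=> Fl; apply: cvg_big => //; exact: mul_continuous. Qed.

Section RewardLimit.
Variables (R : realType) (n : nat) (y0 : bits n) (f : nat -> bits n -> bits n -> nat).
Hypothesis f_mono : forall t x y, (4 * f t x y <= f t.+1 x y)%N.
Hypothesis f_le : forall t, (\sum_(x : bits n) \sum_(y : bits n) f t x y <= 4 ^ t)%N.

Definition rewardR t x : R := (reward y0 f t x)%:R / (scale n ^ t)%:R.
Definition reward_lim x : R := limn (rewardR ^~ x).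

Lemma scaleX_gt0 t : 0 < (scale n ^ t)%:R :> R.
Proof. by rewrite ltr0n expn_gt0 scale_gt0. Qed.

Lemma rewardR_mono x : nondecreasing_seq (rewardR ^~ x).
Proof.
apply/nondecreasing_seqP => t; rewrite /rewardR ler_pdivrMr ?scaleX_gt0//.
rewrite mulrAC ler_pdivlMr ?scaleX_gt0// -!natrM ler_nat expnS.
by rewrite mulnA leq_mul2r [(_ * scale n)%N]mulnC reward_mono orbT.
Qed.

Lemma rewardR_ge0 t x : 0 <= rewardR t x.
Proof. exact: divr_ge0. Qed.

Lemma sum_rewardR_le1 t : \sum_(x : bits n) rewardR t x <= 1.
Proof.
rewrite -mulr_suml ler_pdivrMr ?scaleX_gt0// mul1r -natr_sum ler_nat.
apply: leq_trans (sum_reward_le _ f_mono _) _.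
exact: leq_trans (level_le _ _ _) (potential_le _ f_le _).
Qed.

Lemma rewardR_cvg (x : bits n) : rewardR ^~ x @ \oo --> reward_lim x.
Proof.
apply: nondecreasing_is_cvgn; first exact: rewardR_mono.
exists 1 => _ [t _ <-]; apply: le_trans (sum_rewardR_le1 t).
by rewrite (bigD1 x)//= lerDl sumr_ge0// => *; exact: rewardR_ge0.
Qed.

Lemma rewardR_le (x : bits n) t : rewardR t x <= reward_lim x.
Proof. by apply: nondecreasing_cvgn_le; [exact: rewardR_mono|exact: rewardR_cvg]. Qed.

Lemma reward_lim_ge0 (x : bits n) : 0 <= reward_lim x.
Proof. exact: le_trans (rewardR_ge0 0 x) (rewardR_le x 0). Qed.

Lemma sum_reward_lim_le (c : R) :
    (forall t, \sum_(x : bits n) rewardR t x <= c) ->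
  \sum_(x : bits n) reward_lim x <= c.
Proof.
move=> h; have Rl := @cvg_sumr R _ (index_enum (bits n)) xpredT _ _
  (fun x _ => @rewardR_cvg x).
apply: (cvgr_to_le Rl).
by apply: nearW => t; exact: h.
Qed.

End RewardLimit.

(** * The separating string, from its properties at the last jump *)

Section Limits.
Variables (R : realType) (n : nat) (y0 : bits n) (f : nat -> bits n -> bits n -> nat).
Variable J : bifun R.

Hypothesis f0 : forall x y, f 0%N x y = 0%N.
Hypothesis f_mono : forall t x y, (4 * f t x y <= f t.+1 x y)%N.
Hypothesis J_le : forall t x y, (f t x y)%:R / (4 ^ t)%:R <= @J n x y.
Hypothesis J_cvg : forall x y, (fun t => (f t x y)%:R / (4 ^ t)%:R) @ \oo --> @J n x y.
Hypothesis J_gt0 : forall x y, 0 < @J n x y.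
Hypothesis J_sum : \sum_(x : bits n) \sum_(y : bits n) @J n x y <= 1.

Let massR t u v : R := (mass f t u v)%:R / (4 ^ t)%:R.
Let numerR t x : R := (numer y0 f t x)%:R / ((4 ^ n) ^ t)%:R.
Let denomR t x : R := (denom y0 f t x)%:R / ((4 ^ n) ^ t)%:R.

Lemma massRE t u v : massR t u v =
  \sum_(x : bits n | prefix u x) \sum_(y : bits n | prefix v y) (f t x y)%:R / (4 ^ t)%:R.
Proof.
rewrite /massR natr_sum mulr_suml; apply: eq_bigr => x _.
by rewrite natr_sum mulr_suml.
Qed.

Lemma mass_le_prefix_sum t u v : massR t u v <= prefix_sum J n u v.
Proof. by rewrite massRE; apply: ler_sum => x _; apply: ler_sum. Qed.

Lemma mass_cvg u v : (fun t => massR t u v) @ \oo --> prefix_sum J n u v.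
Proof.
under eq_cvg do rewrite massRE.
by apply: cvg_sumr => x _; apply: cvg_sumr.
Qed.

Let numer_lim x : R := \prod_(i < n) prefix_sum J n (take i.+1 x) (take i y0).
Let denom_lim x : R := \prod_(i < n) prefix_sum J n (take i x) (take i y0).

Lemma numerRE t x : numerR t x = \prod_(i < n) massR t (take i.+1 x) (take i y0).
Proof.
rewrite /numerR /massR big_split/= -natr_prod; congr (_ * _).
by rewrite prodr_const card_ord -expnM mulnC expnM natrX exprVn.
Qed.

Lemma denomRE t x : denomR t x = \prod_(i < n) massR t (take i x) (take i y0).
Proof.
rewrite /denomR /massR big_split/= -natr_prod; congr (_ * _).
by rewrite prodr_const card_ord -expnM mulnC expnM natrX exprVn.
Qed.

Lemma massR_ge0 t u v : 0 <= massR t u v. Proof. exact: divr_ge0. Qed.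

Lemma numer_le_lim t x : numerR t x <= numer_lim x.
Proof. by rewrite numerRE; apply: ler_prod => i _; rewrite massR_ge0 mass_le_prefix_sum. Qed.

Lemma denom_le_lim t x : denomR t x <= denom_lim x.
Proof. by rewrite denomRE; apply: ler_prod => i _; rewrite massR_ge0 mass_le_prefix_sum. Qed.

Lemma potentialRE t : (potential y0 f t)%:R / (scale n ^ t)%:R =
  \prod_(x : bits n) numerR t x.
Proof.
rewrite /numerR big_split/= -natr_prod; congr (_ * _).
rewrite prodr_const card_tuple card_bool exprVn -natrX; congr (_%:R^-1).
by rewrite /scale -!expnM [(2 ^ n * t)%N]mulnC.
Qed.

Lemma potential_cvg :
  (fun t => (potential y0 f t)%:R / (scale n ^ t)%:R) @ \oo --> \prod_(x : bits n) numer_lim x.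
Proof.
under eq_cvg do rewrite potentialRE.
apply: cvg_prodr => x _; under eq_cvg do rewrite numerRE.
by apply: cvg_prodr => i _; exact: mass_cvg.
Qed.

Lemma prefix_sum_gt0 (x y : bits n) i j : 0 < prefix_sum J n (take i x) (take j y).
Proof.
rewrite /prefix_sum (bigD1 x)/=; last by rewrite prefix_take.
rewrite (bigD1 y)/=; last by rewrite prefix_take.
have J_ge0 x' y' : 0 <= @J n x' y' by exact/ltW/J_gt0.
apply: ltr_wpDr; first by apply: sumr_ge0 => x' _; apply: sumr_ge0.
by apply: ltr_wpDr => //; apply: sumr_ge0.
Qed.

Lemma numer_lim_gt0 (x : bits n) : 0 < numer_lim x.
Proof. by apply: prodr_gt0 => i _; exact: prefix_sum_gt0. Qed.

Lemma approx_sum_le t : (\sum_(x : bits n) \sum_(y : bits n) f t x y <= 4 ^ t)%N.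
Proof.
rewrite -(ler_nat R) -[leRHS]mul1r -ler_pdivrMr ?ltr0n ?expn_gt0//.
apply: le_trans J_sum; rewrite natr_sum mulr_suml; apply: ler_sum => x _.
by rewrite natr_sum mulr_suml; apply: ler_sum => y _.
Qed.

(** Positivity of [J] makes the limit of the normalized potential a product of positive numbers, so
    the approximations become positive too. *)
Lemma potential_gt0 : exists t, (0 < potential y0 f t)%N.
Proof.
have pl : 0 < \prod_(x : bits n) numer_lim x.
  by apply: prodr_gt0 => x _; exact: numer_lim_gt0.
have [N _ HN] := cvgr_gt _ potential_cvg _ pl.
exists N; have := HN N (leqnn N); rewrite /=.
by case: posnP => // ->; rewrite mul0r ltxx.
Qed.

Lemma separation : (0 < n)%N -> exists z : bits n,
  [/\ causal J z y0 <= 2 / (2 ^ n)%:R, 0 < reward_lim R y0 f z &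
      \sum_(x : bits n) reward_lim R y0 f x <= 2 * reward_lim R y0 f z].
Proof.
move=> n0.
have [s [j [z [gz pots pott rewt rews]]]] :=
  last_jump f_mono approx_sum_le f0 n0 potential_gt0.
have j0 : 0 < (2 ^ j)%:R :> R by rewrite ltr0n expn_gt0.
(* The last jump alone gives [z] half of [1 / 2 ^ j], which bounds the total reward at all times. *)
have rz : (2 ^ j)%:R^-1 <= 2 * reward_lim R y0 f z.
  apply: le_trans (_ : 2 * rewardR R y0 f s z <= _); last first.
    by rewrite ler_pM2l ?(rewardR_le _ _ f_mono approx_sum_le).
  rewrite /rewardR mulrA ler_pdivlMr ?scaleX_gt0// ler_pdivrMl//.
  by rewrite -!natrM ler_nat mulnA [(2 ^ j * 2)%N]mulnC.
exists z; split; last first.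
- apply: le_trans rz; apply: (sum_reward_lim_le f_mono approx_sum_le) => t.
  rewrite -mulr_suml ler_pdivrMr ?scaleX_gt0// ler_pdivlMl//.
  by rewrite -natr_sum -natrM ler_nat.
- have : 0 < 2 * reward_lim R y0 f z by apply: lt_le_trans rz; rewrite invr_gt0.
  by rewrite pmulr_rgt0.
(* All normalized potentials are at most [2 / 2 ^ j], hence so is their limit, while the one at time
   [s] is at least [1 / 2 ^ j]. *)
have potlim : \prod_(x : bits n) numer_lim x <= 2 * ((potential y0 f s)%:R / (scale n ^ s)%:R).
  apply: cvgr_to_le potential_cvg _; apply: nearW => t.
  apply: le_trans (_ : 2 / (2 ^ j)%:R <= _).
    rewrite ler_pdivrMr ?scaleX_gt0// mulrAC ler_pdivlMr// -!natrM ler_nat.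
    by rewrite mulnC.
  rewrite ler_pM2l// ler_pdivlMr ?scaleX_gt0// ler_pdivrMl//.
  by rewrite -natrM ler_nat.
(* Every other factor of the potential is below its positive limit, which can be cancelled: the
   factor of [z] alone cannot more than double after [s]. *)
have numz : numer_lim z <= 2 * numerR s z.
  move: potlim; rewrite potentialRE (bigD1 z)//= [X in _ <= _ * X](bigD1 z)//= => h.
  have rest0 : 0 < \prod_(x | x != z) numer_lim x.
    by apply: prodr_gt0 => x _; exact: numer_lim_gt0.
  rewrite -(ler_pM2r rest0); apply: le_trans h _; rewrite mulrA ler_wpM2l//.
    by rewrite mulr_ge0// divr_ge0.
  by apply: ler_prod => x _; rewrite numer_le_lim divr_ge0.
rewrite /causal prodf_div -/(numer_lim z) -/(denom_lim z).
have den0 : 0 < denom_lim z by apply: prodr_gt0 => i _; exact: prefix_sum_gt0.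
rewrite ler_pdivrMr// mulrAC ler_pdivlMr ?ltr0n ?expn_gt0//.
apply: le_trans (_ : 2 * numerR s z * (2 ^ n)%:R <= _); first by rewrite ler_wpM2r.
(* The denominator only grows, so the greedy bound at time [s] carries over to the limit. *)
rewrite -mulrA ler_pM2l//; apply: le_trans (denom_le_lim s z).
rewrite /numerR /denomR mulrAC ler_wpM2r ?invr_ge0// -natrM ler_nat mulnC.
by apply: greedy_denom; rewrite ?size_tuple.
Qed.

End Limits.

(** With all mass on [y0], summing over extensions of a prefix of [y0] only contributes [w]. The
    numerator of each factor is then the denominator of the next and the product telescopes;
    [0 < q z] keeps the denominators nonzero. *)
Lemma causal_dirac (R : realType) (J : bifun R) n (y0 z : bits n) (q : bits n -> R) (w : R) :
    (0 < n)%N -> w != 0 -> (forall x, 0 <= q x) -> 0 < q z ->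
    (forall x y : bits n, J n x y = if y == y0 then q x * w else 0) ->
  causal J z y0 = q z / \sum_(x : bits n) q x.
Proof.
move=> n0 w0 q0 qz JE.
pose F k := \sum_(x : bits n | prefix (take k z) x) q x.
have pE u k : prefix_sum J n u (take k y0) = (\sum_(x : bits n | prefix u x) q x) * w.
  rewrite /prefix_sum mulr_suml; apply: eq_bigr => x _.
  rewrite (bigD1 y0) ?prefix_take//= JE eqxx big1 ?addr0// => y /andP[_ /negbTE yy0].
  by rewrite JE yy0.
have F0 k : F k != 0.
  rewrite /F (bigD1 z) ?prefix_take//= gt_eqF// ltr_wpDr//.
  by apply: sumr_ge0.
rewrite /causal; under eq_bigr do rewrite !pE -mulf_div divff// mulr1.
rewrite -(big_mkord xpredT (fun i => F i.+1 / F i)) telescope_prodf//.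
congr (_ / _).
  rewrite /F take_oversize ?size_tuple// (bigD1 z) ?prefix_refl//=.
  rewrite big1 ?addr0// => x /andP[zx xz].
  case/eqP: xz; apply/val_inj/eqP.
  by move: zx; rewrite prefixE size_tuple take_oversize ?size_tuple.
by rewrite /F take0; apply: eq_bigl => x; rewrite prefix0s.
Qed.

(** * The separating semimeasure and its enumerability *)

Section Assembly.
Variables (R : realType) (A : nat -> nat -> nat -> nat).
Hypothesis recA : Rec 3 (fun s => A (arg s 0%N) (arg s 1%N) (arg s 2%N)).

Definition separator : bifun R := fun n x y =>
  if y == zeros n then reward_lim R (zeros n) (approx A (n:=n)) x else 0.

Hypothesis A_mono : forall n t (x y : bits n), (4 * approx A t x y <= approx A t.+1 x y)%N.
Hypothesis A_le : forall n t,
  (\sum_(x : bits n) \sum_(y : bits n) approx A t x y <= 4 ^ t)%N.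

Lemma enumerable2_separator : enumerable2 separator.
Proof.
(* The string [y] is all zeros exactly when its code is a power of 2; [n] is recovered from the code
   of [x]. *)
pose num v := ((arg v 2 == 2 ^ trunc_log 2 (arg v 2)) *
  reward_code A (arg v 0) (trunc_log 2 (arg v 1)) (arg v 1))%N.
pose den v := (((4 ^ trunc_log 2 (arg v 1)) ^ (2 ^ trunc_log 2 (arg v 1))) ^ arg v 0)%N.
exists (fun v => ((num v)%:R - 0%:R) / ((den v).-1).+1%:R).
  exists num, (fun=> 0%N), (fun v => (den v).-1); split=> //.
  - suff : Rec 3 num by [].
    by rewrite /num; rec_arith; apply: (Rec_comp3 (Rec_reward_code recA)); rec_arith.
  - exact: (Rec_const 3 0).
  - suff : Rec 3 (fun s => (den s).-1) by [].
    by apply: Rec_pred; rewrite /den; rec_arith.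
move=> n x y.
have denE t : ((den [:: t; bits_code x; bits_code y]).-1.+1)%N = (scale n ^ t)%N.
  by rewrite /den /= trunc_log_bits_code prednK// !expn_gt0.
have numE t : num [:: t; bits_code x; bits_code y] =
    ((y == zeros n) * reward (zeros n) (approx A (n:=n)) t x)%N.
  rewrite /num /= !trunc_log_bits_code reward_codeE; congr (nat_of_bool _ * _)%N.
  rewrite -bits_code_nseq; apply/eqP/eqP => [/bits_code_inj E|->//].
  by apply/val_inj/E; rewrite size_nseq size_tuple.
have gE t : ratr (((num [:: t; bits_code x; bits_code y])%:R - 0%:R) /
    ((den [:: t; bits_code x; bits_code y]).-1.+1)%:R) =
    (y == zeros n)%:R * rewardR R (zeros n) (approx A (n:=n)) t x.
  by rewrite subr0 denE numE fmorph_div/= !ratr_nat natrM mulrA.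
split.
  by move=> s t st; rewrite -(ler_rat R) !gE ler_wpM2l// rewardR_mono.
rewrite /separator; move: gE; case: eqP => _ gE.
  rewrite (_ : (fun t => ratr _) = rewardR R (zeros n) (approx A (n:=n)) ^~ x).
    exact: (rewardR_cvg (@A_mono n) (@A_le n)).
  by apply/funext => t; rewrite /= gE mul1r.
rewrite (_ : (fun t => ratr _) = cst 0); first exact: cvg_cst.
by apply/funext => t; rewrite /= gE mul0r.
Qed.
End Assembly.

Theorem proposition3p3 (R : realType) (P PC : bifun R)
    (P_cond : conditional_semimeasure P) (P_enum : enumerable2 P)
    (P_pos : forall (n : nat) (x y : bits n), 0 < P n x y)
    (P_causal : causal_associated P PC) :
  exists (Q QC : bifun R) (c : R),
    [/\ conditional_semimeasure Q, enumerable2 Q, causal_associated Q QC,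
        0 < c &
        \forall n \near \oo, exists x y : bits n,
          c * n%:R < log2 (QC n x y / PC n x y)].
Proof.
have [p [J [[p_ge0 p_sum] p_enum p_gt0 [[J_ge0 J_sum] JE] PCE]]] := P_causal.
have [A recA AP] := enumerable2_dyadic P_enum P_cond.1.
have [B recB BP] := enumerable1_dyadic p_enum p_ge0.
(* Numerators over [2 ^ t] for P and for its marginal multiply to numerators over [4 ^ t] for
   [J]. *)
pose AB t x y := (A t x y * B t y)%N.
have recAB : Rec 3 (fun s => AB (arg s 0%N) (arg s 1%N) (arg s 2%N)).
  apply: Rec_mul; first exact: recA.
  by apply: (Rec_comp2 recB); rec_arith.
have AB0 n (x y : bits n) : approx AB 0%N x y = 0%N.
  by rewrite /approx /AB; have [-> _ _ _] := AP n x y.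
have AB_mono n t (x y : bits n) : (4 * approx AB t x y <= approx AB t.+1 x y)%N.
  have [_ A2 _ _] := AP n x y; have [_ B2 _ _] := BP n y.
  by have := leq_mul (A2 t) (B2 t); rewrite mulnACA.
have ABE n t (x y : bits n) : (approx AB t x y)%:R / (4 ^ t)%:R =
    (A t (bits_code x) (bits_code y))%:R / (2 ^ t)%:R *
    ((B t (bits_code y))%:R / (2 ^ t)%:R) :> R.
  by rewrite mulf_div -!natrM -expnMn.
have AB_le n t (x y : bits n) : (approx AB t x y)%:R / (4 ^ t)%:R <= J n x y.
  have [_ _ A_le _] := AP n x y; have [_ _ B_le _] := BP n y.
  by rewrite ABE JE; apply: ler_pM; rewrite ?divr_ge0.
have AB_cvg n (x y : bits n) :
    (fun t => (approx AB t x y)%:R / (4 ^ t)%:R) @ \oo --> J n x y.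
  have [_ _ _ A_cvg] := AP n x y; have [_ _ _ B_cvg] := BP n y.
  by under eq_cvg do rewrite ABE; rewrite JE; exact: cvgM.
have J_gt0 n (x y : bits n) : 0 < J n x y by rewrite JE mulr_gt0.
have AB_sum n t := approx_sum_le (AB_le n) (J_sum n) t.
pose Q := separator R AB; pose q : unifun R := fun n _ => (2 ^ n)%:R^-1.
have Q_ge0 n x y : 0 <= Q n x y.
  rewrite /Q /separator; case: ifP => // _.
  exact: (reward_lim_ge0 _ _ (AB_mono n) (AB_sum n)).
have Q_sum n (y : bits n) : \sum_(x : bits n) Q n x y <= 1.
  rewrite /Q /separator; case: eqP => _; last by rewrite big1.
  apply: (sum_reward_lim_le (AB_mono n) (AB_sum n)) => t.
  exact: (sum_rewardR_le1 _ _ (AB_mono n) (AB_sum n)).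
have q_gt0 n (y : bits n) : 0 < q n y by rewrite invr_gt0 ltr0n expn_gt0.
have q_sum n : \sum_(y : bits n) q n y <= 1.
  by rewrite /q sumr_const card_tuple card_bool -[leLHS]mulr_natr mulVf ?pnatr_eq0 ?expn_eq0.
pose JQ : bifun R := fun n x y => Q n x y * q n y.
(* The ratio will be at least [2 ^ (n - 2)], so every constant below 1 would do; for one half,
   [n / 2 < n - 2] holds from [n = 5] on. *)
exists Q, (fun n => @causal R JQ n), (2^-1); split => //.
- exact: enumerable2_separator.
- exists q, JQ; split => //.
  + by split=> // n y; exact: ltW.
  + exact: enumerable1_uniform.
  + split=> //; split=> [n x y|n]; first by rewrite mulr_ge0// ltW.
    rewrite exchange_big/=; apply: le_trans (q_sum n).
    apply: ler_sum => y _; rewrite -mulr_suml.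
    by apply: ler_piMl; [exact: ltW|exact: Q_sum].
exists 5%N => // n /= n5; have n0 : (0 < n)%N by apply: leq_trans n5.
have [z [Pz rz sumz]] := separation (zeros n) (AB0 n) (AB_mono n) (AB_le n) (AB_cvg n)
  (J_gt0 n) (J_sum n) n0.
exists z, (zeros n); rewrite PCE.
(* The telescoped causal probability is the share of [z] in the total reward, which is at least one
   half. *)
have Qz : causal JQ z (zeros n) >= 2^-1.
  rewrite (@causal_dirac R JQ n _ z (reward_lim R (zeros n) (approx AB (n:=n)))
    (2 ^ n)%:R^-1)//.
  - have s0 : 0 < \sum_(x : bits n) reward_lim R (zeros n) (approx AB (n:=n)) x.
      rewrite (bigD1 z)//= ltr_wpDr// sumr_ge0// => x _.
      exact: (reward_lim_ge0 _ _ (AB_mono n) (AB_sum n)).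
    by rewrite ler_pdivlMr// ler_pdivrMl.
  - by move=> x; exact: (reward_lim_ge0 _ _ (AB_mono n) (AB_sum n)).
  - move=> x y; rewrite /JQ /Q /separator; case: ifP => // _; exact: mul0r.
(* Positivity ensures that the ratio is a genuine quotient and not the default value 0. *)
have Pz0 : 0 < causal J z (zeros n).
  by apply: prodr_gt0 => i _; rewrite divr_gt0// (prefix_sum_gt0 (J_gt0 n)).
(* Dividing the lower bound [1 / 2] by the upper bound [2 / 2 ^ n] gives [2 ^ (n - 2)]. *)
have ratio : 2 ^+ (n - 2) <= causal JQ z (zeros n) / causal J z (zeros n) :> R.
  rewrite ler_pdivlMr//; apply: le_trans Qz.
  apply: le_trans (_ : 2 ^+ (n - 2) * (2 / (2 ^ n)%:R) <= _).
    by rewrite ler_wpM2l// exprn_ge0.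
  have n2 : (2 <= n)%N by apply: leq_trans n5.
  rewrite mulrA ler_pdivrMr ?ltr0n ?expn_gt0// ler_pdivlMl// natrX.
  have -> : 2 ^+ n = 2 ^+ (n - 2) * (2 * 2) :> R by rewrite -expr2 -exprD subnK.
  by rewrite mulrC mulrA.
have ln2 : 0 < ln 2 :> R by rewrite ln_gt0// ltr1n.
rewrite /log2 ltr_pdivlMr//.
apply: lt_le_trans (_ : ln (2 ^+ (n - 2)) <= _); last first.
  by rewrite ler_ln// posrE ?exprn_gt0// (lt_le_trans _ ratio)// exprn_gt0.
rewrite lnXn// -[ltRHS]mulr_natl ltr_pM2r// ltr_pdivrMl// -natrM ltr_nat.
lia.
Qed.
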